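(* For $n\ge1$, $$\sum_{\pi\in\mathrm{PPF}(n+1)}x^{\mathrm{lel}(\pi)}y^{\mathrm{one}(\pi)}=x(n-1+x+y)^{n-1}\big((n-1)y-x-(n-1)\big)+x(n-1+x)^n+x^2y^2(n+xy)^{n-1}.$$
   Context: A parking function of length $N$ is a sequence $\pi=(\pi_1,\dots,\pi_N)$ of positive integers whose increasing rearrangement $b_1\le\dots\le b_N$ satisfies $b_i\le i$. It is prime if for every $1\le j\le N-1$ at least $j+1$ of the entries are $\le j$; $\mathrm{PPF}(N)$ is the set of prime parking functions of length $N$. $\mathrm{lel}(\pi)=\#\{i:\pi_i=\pi_1\}$ and $\mathrm{one}(\pi)=\#\{i:\pi_i=1\}$. *)

(* Defs.v *)
From mathcomp Require Import all_boot all_order all_algebra.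

Set Implicit Arguments.
Unset Strict Implicit.
Unset Printing Implicit Defensive.

(* Sequences are indexed from 0 and their entries are the actual (1-based)
   values, so the condition b_i <= i on the increasing rearrangement b reads
   b_(i+1) <= i+1 for i < size s. *)
Definition parking_function (s : seq nat) : bool :=
  all (fun a => 0 < a) s &&
  [forall i : 'I_(size s), nth 0 (sort leq s) i <= i.+1].

Definition prime_parking_function (s : seq nat) : bool :=
  parking_function s &&
  [forall j : 'I_(size s), (0 < j) ==> (j.+1 <= count (fun a => a <= j) s)].

Definition lel (s : seq nat) : nat := count_mem (head 0 s) s.

Definition ones (s : seq nat) : nat := count_mem 1 s.

(* Tuples over 'I_N.+1 make the index type finite: the entries of a parking
   function of length N are at most N, so nothing is lost (PPF_complete). *)
Definition entries (N : nat) (p : N.-tuple 'I_N.+1) : seq nat :=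
  [seq val a | a <- p].

Definition PPF (N : nat) : {set N.-tuple 'I_N.+1} :=
  [set p | prime_parking_function (entries p)].

Lemma entries_inj (N : nat) : injective (@entries N).
Proof. by move=> p q /(inj_map val_inj) /val_inj. Qed.

Lemma parking_function_le (s : seq nat) (a : nat) :
  parking_function s -> a \in s -> a <= size s.
Proof.
case/andP=> _ /forallP sP; rewrite -(mem_sort leq) => /(nthP 0) [i].
rewrite size_sort => lt_i <-.
exact: leq_trans (sP (Ordinal lt_i)) lt_i.
Qed.

Lemma PPF_complete (N : nat) (s : seq nat) :
  size s = N -> prime_parking_function s ->
  exists2 p, p \in PPF N & entries p = s.
Proof.
move=> sz_s sP; have s_le a : a \in s -> a < N.+1.
  by move=> sa; rewrite ltnS -sz_s parking_function_le //; case/andP: sP.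
have sz_t : size [seq (inord a : 'I_N.+1) | a <- s] == N.
  by rewrite size_map sz_s.
have eq_s : entries (Tuple sz_t) = s.
  rewrite /entries /= -map_comp -[RHS]map_id.
  by apply/eq_in_map => a sa /=; rewrite inordK ?s_le.
by exists (Tuple sz_t); rewrite ?inE ?eq_s.
Qed.

(* Main.v *)
Require Import Defs.
From mathcomp Require Import all_boot all_order all_algebra.
From mathcomp Require Import zify ring.
Import GRing.Theory.
Local Open Scope ring_scope.

(** Delete the ones of a word and lower the other letters by 1. If the word has
    length m and letters at most K + 1, and satisfies "more than j of the
    letters, counted with a extra ones, are at most j" for all j <= K + 1, then
    the shorter word satisfies the same condition for K, with a + k - 1 extra
    ones, where k is the number of ones deleted. With a = 0 the condition is
    primality, and all the extra-ones parameters reached from it are positive.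
    For positive a this recursion, by the binomial theorem, evaluates the sum
    of z^one to (K + z)^m - m (K + z)^(m-1) when a + m = K + 1. Splitting on
    whether the first letter is 1, it then evaluates the sum of x^lel to
    a x (x + K)^(m-1), and one more deletion step at a = 0, keeping track of y,
    gives the three terms of the theorem: the last one comes from the words
    starting with 1, and x (n - 1 + x)^n compensates the term k = 0, which the
    binomial sum contains but which no prime parking function attains. *)

(** * Words and the deletion of ones *)

Fixpoint words (K m : nat) : seq (seq nat) :=
  if m is m'.+1 then [seq c :: w | c <- iota 1 K, w <- words K m'] else [:: [::]].

Lemma mem_words (K m : nat) (w : seq nat) :
  (w \in words K m) = (size w == m) && all (mem (iota 1 K)) w.
Proof.
elim: m w => [|m IHm] [|c w] //=; first by apply/negbTE/allpairsP => -[[]] ? ? [].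
rewrite eqSS; apply/allpairsP/idP => [[[c' w'] /= [c'K w'K [-> ->]]]|].
  by rewrite c'K andTb -IHm.
by case/and3P=> sz_w cK wK; exists (c, w); split=> //=; rewrite IHm sz_w.
Qed.

Lemma words_uniq (K m : nat) : uniq (words K m).
Proof.
elim: m => //= m IHm; apply: allpairs_uniq; rewrite ?iota_uniq //.
by move=> [c w] [c' w'] _ _ [-> ->].
Qed.

Definition strip (w : seq nat) : seq nat := [seq c.-1 | c <- w & c != 1%N].

Lemma count_strip (j : nat) (w : seq nat) :
  count (fun c => c <= j.+1)%N w =
    (count_mem 1%N w + count (fun c => c <= j)%N (strip w))%N.
Proof.
elim: w => //= c w ->; rewrite /strip /=.
by case: eqVneq => [->|] /=; case: c => [|c] //= _; rewrite ?ltnS; lia.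
Qed.

Lemma count_mem_strip (c : nat) (w : seq nat) :
  (0 < c)%N -> count_mem c.+1 w = count_mem c (strip w).
Proof.
move=> c_gt0; elim: w => //= d w ->; rewrite /strip /=.
by case: (eqVneq d 1%N) => [->|] /=; [lia | case: d => [|d] //=; lia].
Qed.

(* [a] counts extra ones; [park n 0] is primality in length n + 1. *)
Definition park (K a : nat) (w : seq nat) : bool :=
  all (fun j => j < a + count (fun c => c <= j)%N w)%N (iota 1 K).

(** With [k] ones in [w], the test at 1 becomes [1 < a + k], and the test at [j + 1] becomes the
    test at [j] on the stripped word. Under [1 < a + k] the predecessor is a true subtraction. *)
Lemma park_strip (K a : nat) (w : seq nat) :
  0%N \notin w ->
  park K.+1 a w =
    (1 < a + count_mem 1%N w)%N && park K (a + count_mem 1%N w).-1 (strip w).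
Proof.
move=> w_pos; have no0 : count (fun c => c <= 0)%N (strip w) = 0%N.
  rewrite /strip; elim: w w_pos => //= c w IHw.
  rewrite inE negb_or => /andP[c0 /IHw] IH.
  by case: c c0 => [|[|c]] //=; rewrite IH.
rewrite /park -[K.+1]add1n iotaD all_cat /= andbT count_strip no0 addn0.
have [ak_gt1|//] := ltnP 1; rewrite !andTb (iotaDl 1 1) all_map.
apply: eq_all => j /=; rewrite count_strip addnA; move: (count _ (strip w)) => s.
by move: (a + _)%N ak_gt1 => [|b] //= _; rewrite add1n addSn ltnS.
Qed.

Lemma park_cons1 (K a : nat) (w : seq nat) : park K a (1%N :: w) = park K a.+1 w.
Proof.
by apply/eq_in_all => j; rewrite mem_iota /= => /andP[-> _]; rewrite addnCA add1n addSn.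
Qed.

(** * Sums over words, grouped by the number of ones *)

Section SumWords.
Variable V : nmodType.

Lemma sum_words_cons (K m : nat) (G : seq nat -> V) :
  \sum_(w <- words K m.+1) G w =
    \sum_(c <- iota 1 K) \sum_(w <- words K m) G (c :: w).
Proof. exact: big_allpairs_dep. Qed.

Lemma big_iotaS (K : nat) (g : nat -> V) :
  \sum_(c <- iota 1 K.+1) g c = g 1%N + \sum_(c <- iota 1 K) g c.+1.
Proof. by rewrite /= big_cons (iotaDl 1 1) big_map. Qed.

(** A word is determined by the positions of its [k] ones and by its stripped word, which is
    arbitrary. The induction splits on the first letter, so [F] must vary. *)
Lemma sum_words_strip (K m : nat) (F : nat -> seq nat -> V) :
  \sum_(w <- words K.+1 m) F (count_mem 1%N w) (strip w) =
    \sum_(k < m.+1) (\sum_(w <- words K (m - k)) F k w) *+ 'C(m, k).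
Proof.
elim: m F => [|m IHm] F; first by rewrite big_ord1 /= !big_seq1 /= mulr1n.
rewrite sum_words_cons big_iotaS (IHm (fun k => F k.+1)).
under [X in _ + X]eq_big_seq => c.
  rewrite mem_iota => /andP[c_gt0 _].
  under eq_bigr => w _.
    have ->: F (count_mem 1%N (c.+1 :: w)) (strip (c.+1 :: w)) =
             F (count_mem 1%N w) (c :: strip w).
      by rewrite /strip /= eqSS; case: c c_gt0.
    over.
  rewrite (IHm (fun k v => F k (c :: v))).
  over.
rewrite exchange_big /=.
under [X in _ + X]eq_bigr => k _.
  rewrite sumrMnl -sum_words_cons -subSn; last by rewrite -ltnS.
  over.
rewrite [RHS]big_ord_recl [X in _ + X = _]big_ord_recl /= addrCA; congr (_ + _).
  by rewrite !bin0.
(* Pascal's rule: ['C(m, k.+1)] counts the words with first letter other than 1, ['C(m, k)] those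
   starting with 1. *)
under [RHS]eq_bigr => k _ do rewrite /bump /= add1n binS subSS mulrnDr.
rewrite big_split /= addrC [X in _ = X + _]big_ord_recr /= bin_small // mulr0n addr0.
by under [X in X + _ = _]eq_bigr => k _ do rewrite /bump /= add1n subSS.
Qed.
End SumWords.

(** * Derivatives of the binomial theorem *)

Section Binomial.
Variables (R : comNzRingType) (A z : R).

Lemma sum_bin_index (m : nat) :
  \sum_(k < m.+1) (A ^+ (m - k) * z ^+ k *+ k) *+ 'C(m, k) =
    m%:R * z * (A + z) ^+ m.-1.
Proof.
case: m => [|m]; first by rewrite big_ord1 mulr0n mul0rn !mul0r.
rewrite big_ord_recl mulr0n mul0rn add0r exprDn mulr_sumr.
apply: eq_bigr => k _.
by rewrite lift0 subSS -mulrnA -mul_bin_diag mulrnA -mulr_natr exprS mulrnAr /=; ring.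
Qed.

Lemma sum_bin_coindex (m : nat) :
  \sum_(k < m.+1) (A ^+ (m - k).-1 * z ^+ k *+ (m - k)) *+ 'C(m, k) =
    m%:R * (A + z) ^+ m.-1.
Proof.
case: m => [|m]; first by rewrite big_ord1 mulr0n mul0rn !mul0r.
rewrite big_ord_recr /= subnn mulr0n mul0rn. rewrite [LHS]addr0 exprDn mulr_sumr.
apply: eq_bigr => k _ /=.
have lekm : (k <= m)%N by rewrite -ltnS.
by rewrite -mulrnA -mul_bin_down subSn // mulrnA mulrnAr -mulr_natr; ring.
Qed.
End Binomial.

(** * Closed forms for the sums over [park] words *)

Section ParkSums.
Variable R : comNzRingType.
Implicit Types x y z : R.

Lemma notin0_words (K m : nat) (w : seq nat) : w \in words K m -> 0%N \notin w.
Proof.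
rewrite mem_words => /andP[_ /allP wK]; apply/negP => /wK.
by rewrite /= mem_iota.
Qed.

Lemma sum_park_ones (K a m : nat) z :
  (0 < a)%N -> (a + m)%N = K.+1 ->
  \sum_(w <- words K m) (park K a w)%:R * z ^+ count_mem 1%N w =
    (K%:R + z) ^+ m - m%:R * (K%:R + z) ^+ m.-1.
Proof.
elim: K a m z => [|K IHK] a m z a_gt0 amK.
  have [-> ->] : a = 1%N /\ m = 0%N by lia.
  by rewrite big_seq1 mul0r subr0 !expr0 mulr1.
pose F k v : R := ((1 < a + k)%N && park K (a + k).-1 v)%:R * z ^+ k.
under eq_big_seq => w /notin0_words w0.
  have ->: (park K.+1 a w)%:R * z ^+ count_mem 1%N w = F (count_mem 1%N w) (strip w).
    by rewrite park_strip.
  over.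
rewrite sum_words_strip.
(* The deleted ones carry the weight [z ^+ k], so the induction hypothesis is used at [z = 1]. *)
transitivity (\sum_(k < m.+1)
    ((K.+1%:R ^+ (m - k) * z ^+ k) *+ 'C(m, k)
     - (K.+1%:R ^+ (m - k).-1 * z ^+ k *+ (m - k)) *+ 'C(m, k))).
  apply: eq_bigr => k _; rewrite -mulrnBl; congr (_ *+ _).
  have lekm : (k <= m)%N by rewrite -ltnS.
  rewrite -mulr_suml -mulrnAl -mulrBl; congr (_ * _).
  have [ak_gt1|ak_le1] := ltnP 1 (a + k).
    have lKm : ((a + k).-1 + (m - k) = K.+1)%N by lia.
    have := IHK _ _ 1 _ lKm; rewrite natr1 mulr_natl => <-; last by lia.
    by apply: eq_bigr => v _; rewrite expr1n mulr1.
  (* Without ones and with [a = 1] no word qualifies; the closed form also vanishes, since then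
     [m = K.+1]. *)
  have [-> ->] : k = 0%N :> nat /\ m = K.+1 by lia.
  by rewrite big1 // subn0 exprS mulr_natl subrr.
by rewrite sumrB -exprDn sum_bin_coindex.
Qed.

(** The truncated predecessor of [a + k] is [a - 1 + k], plus 1 when [a = k = 0]; this correction
    yields the term in [B ^+ m]. *)
Lemma sum_bin_pred (a m : nat) (B y : R) :
  \sum_(k < m.+1) ((a + k).-1%:R * (B ^+ (m - k) * y ^+ k)) *+ 'C(m, k) =
    (a%:R - 1) * (B + y) ^+ m + m%:R * y * (B + y) ^+ m.-1
    + (a == 0%N)%:R * B ^+ m.
Proof.
have pred_nat (k : nat) : (a + k).-1%:R = (a%:R - 1) + k%:R + ((a + k)%N == 0%N)%:R :> R.
  case: (posnP (a + k)) => [ak0|ak_gt0].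
    have [-> ->] : a = 0%N /\ k = 0%N by lia.
    by rewrite /=; ring.
  by rewrite addr0 addrAC -natrD -[in RHS](prednK ak_gt0) -natr1 addrK.
move: (a%:R - 1) pred_nat => c pred_nat.
under eq_bigr => k _ do rewrite pred_nat !mulrDl !mulrnDl.
rewrite !big_split /=; congr (_ + _ + _).
- by rewrite exprDn mulr_sumr; apply: eq_bigr => k _; rewrite mulrnAr.
- by rewrite -sum_bin_index; apply: eq_bigr => k _; rewrite mulr_natl.
rewrite big_ord_recl big1 => [|k _]; last by rewrite addnS /= mul0r mul0rn.
by rewrite addn0 subn0 bin0 expr0 mulr1 addr0.
Qed.

Lemma sum_park_lel_cons (K a m : nat) x y :
  (a + m)%N = K.+1 ->
  \sum_(w <- words K.+1 m.+1) (park K.+1 a w)%:R * (x ^+ lel w * y ^+ ones w) =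
    x * y * ((K.+1%:R + x * y) ^+ m - m%:R * (K.+1%:R + x * y) ^+ m.-1)
    + \sum_(k < m.+1) ((1 < a + k)%N%:R * y ^+ k *
        \sum_(w <- words K (m - k).+1) (park K (a + k).-1 w)%:R * x ^+ lel w)
        *+ 'C(m, k).
Proof.
move=> amK; rewrite sum_words_cons big_iotaS; congr (_ + _).
  (* If the first letter is 1, then [lel] and [ones] agree, so each one weighs [x * y]; the leading
     one joins the extra ones. *)
  rewrite -(@sum_park_ones _ a.+1) ?addSn ?amK // mulr_sumr.
  apply: eq_bigr => w _; rewrite park_cons1 /lel /ones /= add1n !exprS exprMn.
  ring.
pose F c k v : R :=
  (1 < a + k)%N%:R * y ^+ k * ((park K (a + k).-1 (c :: v))%:R * x ^+ lel (c :: v)).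
transitivity (\sum_(c <- iota 1 K)
    \sum_(w <- words K.+1 m) F c (count_mem 1%N w) (strip w)).
  apply: eq_big_seq => c; rewrite mem_iota => /andP[c_gt0 _].
  apply: eq_big_seq => w /notin0_words w0.
  have cw0 : 0%N \notin c.+1 :: w by [].
  have strip_cw : strip (c.+1 :: w) = c :: strip w.
    by rewrite /strip /= eqSS; case: c c_gt0 {cw0}.
  have ones_cw : count_mem 1%N (c.+1 :: w) = count_mem 1%N w.
    by rewrite /= eqSS; case: c c_gt0 {cw0 strip_cw}.
  have lel_cw : lel (c.+1 :: w) = lel (c :: strip w).
    by rewrite /lel /= !eqxx count_mem_strip.
  rewrite park_strip // strip_cw /ones ones_cw lel_cw /F -mulnb natrM.
  ring.
under eq_bigr => c _ do rewrite sum_words_strip.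
rewrite exchange_big; apply: eq_bigr => k _ /=.
rewrite sumrMnl; congr (_ *+ _).
rewrite (sum_words_cons _ K (m - k)
           (fun w => (park K (a + k).-1 w)%:R * x ^+ lel w)) mulr_sumr.
by apply: eq_bigr => c _; rewrite mulr_sumr.
Qed.

(** The formula for [K] is a hypothesis so that this step serves both the induction in
    [sum_park_lel] ([y = 1], [a > 0]) and the theorem ([a = 0]). *)
Lemma sum_park_lel_ones (K a m : nat) x y :
  (forall b l : nat, (0 < b)%N -> (b + l)%N = K ->
     \sum_(w <- words K l.+1) (park K b w)%:R * x ^+ lel w =
       b%:R * x * (x + K%:R) ^+ l) ->
  (a + m)%N = K.+1 ->
  \sum_(w <- words K.+1 m.+1) (park K.+1 a w)%:R * (x ^+ lel w * y ^+ ones w) =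
    x * y * ((K.+1%:R + x * y) ^+ m - m%:R * (K.+1%:R + x * y) ^+ m.-1)
    + x * ((a%:R - 1) * (x + K%:R + y) ^+ m + m%:R * y * (x + K%:R + y) ^+ m.-1
           + (a == 0%N)%:R * (x + K%:R) ^+ m).
Proof.
move=> sum_lelK amK; rewrite sum_park_lel_cons //; congr (_ + _).
rewrite -sum_bin_pred mulr_sumr; apply: eq_bigr => k _.
rewrite mulrnAr; congr (_ *+ _).
have lekm : (k <= m)%N by rewrite -ltnS.
have [ak_gt1|ak_le1] := ltnP 1 (a + k).
  by rewrite mul1r sum_lelK; [ring | lia | lia].
have ->: (a + k).-1 = 0%N by lia.
by rewrite !mul0r mulr0.
Qed.

Lemma sum_park_lel (K a m : nat) x :
  (0 < a)%N -> (a + m)%N = K ->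
  \sum_(w <- words K m.+1) (park K a w)%:R * x ^+ lel w =
    a%:R * x * (x + K%:R) ^+ m.
Proof.
elim: K a m => [|K IHK] a m a_gt0 amK; first by lia.
under eq_bigr => w _.
  have ->: x ^+ lel w = x ^+ lel w * 1 ^+ ones w by rewrite expr1n mulr1.
  over.
(* At [y = 1] both bases are [x + K + 1]; the terms with factor [m] cancel and [1 + (a - 1) = a]
   remains. *)
rewrite sum_park_lel_ones // gtn_eqF // mul0r addr0 -addrA natr1 !mulr1.
case: m amK => [|m] amK; first by rewrite !expr0; ring.
have ->: K.+1%:R = a%:R + m.+1%:R :> R by rewrite -natrD amK.
by rewrite exprS [_ + x]addrC exprS /=; ring.
Qed.

End ParkSums.

Lemma prime_parking_words (n : nat) (w : seq nat) :
  (0 < n)%N -> size w = n.+1 ->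
  prime_parking_function w = all (mem (iota 1 n)) w && park n 0 w.
Proof.
move=> n_gt0 sz_w; apply/idP/idP.
  case/andP=> /andP[/allP w_pos _] /forallP w_count.
  have count_w j : (0 < j)%N -> (j <= n)%N -> (j < count (fun c => c <= j)%N w)%N.
    move=> j_gt0 j_le; have ltj : (j < size w)%N by rewrite sz_w.
    by have /implyP := w_count (Ordinal ltj); apply.
  apply/andP; split; last first.
    by apply/allP => j; rewrite mem_iota => /andP[j0 jn]; apply: count_w; lia.
  (* Primality at [j = n] forces all [n + 1] letters to be at most [n]; this is where [0 < n]
     enters. *)
  have: all (fun c => c <= n)%N w.
    by rewrite all_count eqn_leq count_size sz_w count_w.
  move=> /allP w_le; apply/allP => c cw /=.
  by rewrite mem_iota w_pos //= add1n ltnS w_le.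
case/andP=> /allP w_mem /allP w_park.
have w_in c : c \in w -> (0 < c <= n)%N by move/w_mem; rewrite /= mem_iota; lia.
have count_w j : (0 < j)%N -> (j <= n)%N -> (j < count (fun c => c <= j)%N w)%N.
  by move=> j_gt0 j_le; apply: (w_park j); rewrite mem_iota; lia.
apply/andP; split; last first.
  apply/forallP => j; apply/implyP => j_gt0; apply: count_w => //.
  by have := ltn_ord j; rewrite {2}sz_w.
apply/andP; split; first by apply/allP => c /w_in /andP[].
(* If the sorted letter at index [i] exceeded [i + 1], at most [i] letters would be at most
   [i + 1]. *)
apply/forallP => i; rewrite leqNgt; apply/negP => lt_i.
have lt_in : (i < n.+1)%N by rewrite -sz_w.
have le_in : (i.+1 <= n)%N.
  have: nth 0%N (sort leq w) i \in w by rewrite -(mem_sort leq) mem_nth // size_sort.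
  by move/w_in; lia.
have := count_w i.+1 isT le_in.
have/permPl/permP <- := perm_sort leq w.
rewrite -(cat_take_drop i (sort leq w)) count_cat.
suff ->: count (fun c => c <= i.+1)%N (drop i (sort leq w)) = 0%N.
  have := count_size (fun c => c <= i.+1)%N (take i (sort leq w)).
  rewrite size_take size_sort ltn_ord addn0 => le_i /leq_trans /(_ le_i).
  by rewrite ltnNge leqW.
apply/eqP; rewrite -leqn0 leqNgt -has_count; apply/hasPn => c /(nthP 0%N)[k].
rewrite size_drop size_sort => ltk <-; rewrite nth_drop -ltnNge.
apply: leq_trans lt_i _.
apply: (sorted_leq_nth leq_trans leqnn 0%N (sort_sorted leq_total w)).
- by rewrite inE size_sort.
- by rewrite inE size_sort -ltn_subRL.
exact: leq_addr.
Qed.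

Lemma sum_PPF (V : nmodType) (n : nat) (f : seq nat -> V) :
  (0 < n)%N ->
  \sum_(p in PPF n.+1) f (entries p) = \sum_(w <- words n n.+1 | park n 0 w) f w.
Proof.
move=> n_gt0; rewrite -big_enum -(big_map (@entries _) xpredT f) -[RHS]big_filter.
apply/perm_big/uniq_perm.
- by rewrite map_inj_uniq ?enum_uniq //; apply: entries_inj.
- by rewrite filter_uniq // words_uniq.
move=> w; rewrite mem_filter mem_words andbC; apply/mapP/idP => [[p]|].
  rewrite mem_enum inE => p_prime ->.
  have sz_p : size (entries p) = n.+1 by rewrite size_map size_tuple.
  by rewrite sz_p eqxx andTb -prime_parking_words.
case/andP=> /andP[/eqP sz_w w_mem] w_park.
have w_prime: prime_parking_function w by rewrite (prime_parking_words n) ?w_mem.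
have [p pP pw] := PPF_complete sz_w w_prime.
by exists p; rewrite ?mem_enum.
Qed.

Theorem theorem5p7 (R : comNzRingType) (x y : R) (n : nat) (hn : (1 <= n)%N) :
  \sum_(p in PPF n.+1) x ^+ lel (entries p) * y ^+ ones (entries p) =
    x * (n%:R - 1 + x + y) ^+ (n - 1) * ((n%:R - 1) * y - x - (n%:R - 1))
    + x * (n%:R - 1 + x) ^+ n
    + x ^+ 2 * y ^+ 2 * (n%:R + x * y) ^+ (n - 1).
Proof.
rewrite (@sum_PPF _ n (fun w => x ^+ lel w * y ^+ ones w)) // big_mkcond.
case: n hn => // K _.
transitivity (\sum_(w <- words K.+1 K.+2)
    (park K.+1 0 w)%:R * (x ^+ lel w * y ^+ ones w)).
  by apply: eq_bigr => w _; case: ifP => _; rewrite ?mul1r ?mul0r.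
rewrite sum_park_lel_ones //; last by move=> b l; apply: sum_park_lel.
(* Here [n = K + 1 = m]. Pulling one factor out of each [n]-th power leaves [x * y] in the first
   bracket, which gives the last term of the theorem. *)
rewrite subn1 /= -[K.+1%:R]natr1 addrK [x + _]addrC !exprS.
ring.
Qed.
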